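(* Let $n\ge 1$, $\mathbf{w}\in\mathbb{R}^n_{++}$, $W=\sum_{b=1}^n w_b$, $q>0$, $P\ge 0$, $R_A\ge 0$, $R_B>0$, and consider the two-stage game described in the context. Then: (i) The pre-allocation $\mathbf{p}^*=\frac{P}{W}\mathbf{w}$ maximizes $\pi_A(\mathbf{p},R_A,R_B)$ over $\mathbf{p}\in\Delta_n(P)$. (ii) The resulting equilibrium payoff $\pi_A^*(P,R_A,R_B):=\max_{\mathbf{p}\in\Delta_n(P)}\pi_A(\mathbf{p},R_A,R_B)$ is as follows. - If $qR_B>P$ and $R_A<\dfrac{2(qR_B-P)^2}{P+2(qR_B-P)}$, then $$\pi_A^*(P,R_A,R_B)=W\cdot\frac{R_A}{2(qR_B-P)}.$$ - Otherwise, that is, if $qR_B\le P$, or if $qR_B>P$ and $R_A\ge \dfrac{2(qR_B-P)^2}{P+2(qR_B-P)}$, then $$\pi_A^*(P,R_A,R_B)=W\left(1-\frac{qR_B}{P+R_A+\sqrt{(R_A+P)^2-P^2}}\right).$$ Player $B$'s equilibrium payoff is $W-\pi_A^*(P,R_A,R_B)$.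
   Context: **Battlefields.** There are $n$ battlefields $\mathcal{B}=\{1,\dots,n\}$. Battlefield $b$ has value $w_b>0$, common to both players, and $W=\sum_b w_b$. **Endowments.** Player $A$ has $P\ge 0$ pre-allocated resources and $R_A\ge 0$ real-time resources. Player $B$ has $R_B>0$ real-time resources. The constant $q>0$ is the effectiveness of $B$'s resources relative to $A$'s. **Stage 1.** Player $A$ deterministically chooses a pre-allocation $$\mathbf{p}\in\Delta_n(P):=\Big\{\mathbf{p}\in\mathbb{R}^n_+:\ \textstyle\sum_b p_b=P\Big\}.$$ This choice is binding and revealed to $B$. **Stage 2 (General Lotto game with favoritism).** Each player $i\in\{A,B\}$ simultaneously chooses a strategy, which is any probability distribution $F_i$ over allocations $\mathbf{x}_i\in\mathbb{R}^n_+$ satisfying the budget constraint in expectation: $$\mathbb{E}_{\mathbf{x}_i\sim F_i}\Big[\textstyle\sum_b x_{i,b}\Big]\le R_i.$$ Player $A$ wins battlefield $b$ if $x_{A,b}+p_b>q\,x_{B,b}$; otherwise $B$ wins it. The tie-breaking rule is arbitrary. Player $A$'s payoff is the expected total value of the battlefields it wins, and $B$'s payoff is $W$ minus this. **Equilibrium payoff.** This stage-2 game always has a Nash equilibrium, and the equilibrium payoffs are unique. The unique equilibrium payoff to $A$ for fixed $\mathbf{p}$ is denoted $\pi_A(\mathbf{p},R_A,R_B)$. *)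

(* Defs.v *)
From HB Require Import structures.
From mathcomp Require Import all_boot all_order all_algebra.
From mathcomp Require Import all_classical all_reals all_analysis.
Set Implicit Arguments. Unset Strict Implicit. Unset Printing Implicit Defensive.
Import Order.TTheory GRing.Theory Num.Theory.
Local Open Scope ring_scope.
Local Open Scope classical_set_scope.

Definition preSimplex (R : realType) (n : nat) (P : R) (p : 'I_n -> R) : Prop :=
  (forall b, 0 <= p b) /\ \sum_(b < n) p b = P.

(* A mixed strategy of a player with (expected) budget [Rb]: the law of a
   random allocation X : Omega -> R^n_+, carried by some probability space. *)
Record strategy (R : realType) (n : nat) (Rb : R) := Strategy {
  st_disp : measure_display;
  st_T : measurableType st_disp;
  st_P : probability st_T R;
  st_X : st_T -> 'I_n -> R;
  st_meas : forall b, measurable_fun setT (fun x => st_X x b);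
  st_nonneg : forall x b, 0 <= st_X x b;
  st_budget : (\int[st_P]_x (\sum_(b < n) st_X x b)%:E <= Rb%:E)%E }.

Definition payoffA (R : realType) (n : nat) (w : 'I_n -> R) (q : R)
  (p : 'I_n -> R) (RA RB : R) (FA : strategy n RA) (FB : strategy n RB) : R :=
  \sum_(b < n) w b *
    fine ((st_P FA \x st_P FB)%E
            [set z | q * st_X z.2 b < st_X z.1 b + p b]).

Definition payoffB (R : realType) (n : nat) (w : 'I_n -> R) (q : R)
  (p : 'I_n -> R) (RA RB : R) (FA : strategy n RA) (FB : strategy n RB) : R :=
  \sum_(b < n) w b - payoffA w q p FA FB.

Definition is_nash (R : realType) (n : nat) (w : 'I_n -> R) (q : R)
  (p : 'I_n -> R) (RA RB : R) (FA : strategy n RA) (FB : strategy n RB) : Prop :=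
  (forall FA' : strategy n RA, payoffA w q p FA' FB <= payoffA w q p FA FB) /\
  (forall FB' : strategy n RB, payoffB w q p FA FB' <= payoffB w q p FA FB).

Definition is_eq_payoffA (R : realType) (n : nat) (w : 'I_n -> R) (q : R)
  (p : 'I_n -> R) (RA RB : R) (v : R) : Prop :=
  exists (FA : strategy n RA) (FB : strategy n RB),
    is_nash w q p FA FB /\ payoffA w q p FA FB = v.

Definition piA_star (R : realType) (W q P RA RB : R) : R :=
  if (P < q * RB) && (RA < 2 * (q * RB - P) ^+ 2 / (P + 2 * (q * RB - P)))
  then W * (RA / (2 * (q * RB - P)))
  else W * (1 - q * RB / (P + RA + Num.sqrt ((RA + P) ^+ 2 - P ^+ 2))).

(* Main.v *)
(** Write [Q = q * RB] and [W] for the sum of the [w b].  The game is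
    constant-sum, so it is enough to give [A] a strategy at [pstar] that secures
    [v] against everything, and to give [B], for every pre-allocation [p], a
    strategy that holds [A] to at most [v].

    With [U] uniform on [0, 1], [A] plays [w b / W * max (L * U - c) 0] on
    battlefield [b], with [c >= P].  Then [B] wins [b] with probability at most
    [(c - P + q y W / w b) / L] when sending [y], which is affine in [y], so only
    [B]'s budget matters.  [B] stays out with probability [1 - mu], and otherwise
    sends (in [A]'s units) [p b] plus [w b / W] times a uniform variable on
    [0, h], where [mu * (P + h / 2) = Q]; then [A] wins [b] with probability at
    most [1 - mu + mu / h * x W / w b] when sending [x].

    If [P < Q] and [RA] is below the threshold, take [mu = 1], [h = 2 (Q - P)],
    [L = 2 (Q - P)^2 / RA] and [c = L - h].  Otherwise take [c = P],
    [L = P + h] and [h = RA + sqrt ((RA + P)^2 - P^2)], so that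
    [h^2 = 2 RA (P + h)].  Both bounds then equal [v]. *)
Require Import Defs.
From HB Require Import structures.
From mathcomp Require Import all_boot all_order all_algebra.
From mathcomp Require Import all_classical all_reals all_analysis.
From mathcomp Require Import measurable_realfun ring lra.
Import Order.TTheory GRing.Theory Num.Theory.
Import numFieldNormedType.Exports.
Local Open Scope ring_scope.

(** * Affine integrals and the uniform law on [0, 1] *)

Lemma eq_implies_le d (T : porderType d) (x y : T) : x = y -> (x <= y)%O.
Proof. by move=> ->. Qed.

Lemma integral_affine (R : realType) (a b m k : R) : a <= b ->
  (\int[lebesgue_measure]_(t in `[a, b]%classic) (m + k * t)%:E =
   (m * (b - a) + k * (b ^+ 2 - a ^+ 2) / 2)%:E)%E.
Proof.
rewrite le_eqVlt => /predU1P[->|ab].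
  by rewrite set_itv1 integral_set1 !subrr !mulr0 mul0r addr0.
have dF (x : R) : is_derive x 1 (fun t : R => m * t + k / 2 * t ^+ 2) (m + k * x).
  by apply: is_derive_eq; rewrite /GRing.scale/=; field.
rewrite (@continuous_FTC2 R (fun t : R => m + k * t) (fun t : R => m * t + k / 2 * t ^+ 2))//.
- by rewrite -EFinB; congr EFin; field.
- apply: continuous_subspaceT => x.
  by apply: cvgD; [exact: cvg_cst|apply: cvgM; [exact: cvg_cst|exact: cvg_id]].
- have cF : continuous (fun t : R => m * t + k / 2 * t ^+ 2).
    by move=> x; apply: differentiable_continuous; apply/derivable1_diffP; exact: ex_derive.
  split => //.
  + by apply: cvg_at_right_filter; exact: cF.
  + by apply: cvg_at_left_filter; exact: cF.
- by move=> x _; rewrite derive1E derive_val.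
Qed.

Definition unif01 (R : realType) : probability (measurableTypeR R) R :=
  uniform_prob (@ltr01 R).

(** The interval may leave [0, 1]: its length still bounds the probability, so later bounds above 1
    need no clipping. *)
Lemma unif01_le (R : realType) (S : set R) (a b : R) : a <= b -> measurable S ->
  (forall t, S t -> 0 <= t <= 1 -> a <= t <= b) ->
  (unif01 R S <= (b - a)%:E)%E.
Proof.
move=> ab mS Sab.
have -> : unif01 R S = (\int[unif01 R]_t (\1_S t)%:E)%E.
  by rewrite integral_indic// setIT.
rewrite /unif01 integral_uniform; last 2 first.
- by apply/measurable_EFinP; exact: measurable_indic.
- by move=> t; rewrite lee_fin.
rewrite subr0 invr1 mul1e integral_indic//.
apply: (@le_trans _ _ (lebesgue_measure `[a, b]%classic)).
  apply: le_measure; rewrite ?inE//; first exact: measurableI.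
  by move=> t [St]; rewrite /= !in_itv/=; exact: Sab.
rewrite lebesgue_measure_itv/= lte_fin.
by case: ifPn => // _; rewrite lee_fin subr_ge0.
Qed.

(** A pointwise affine bound integrates to the same bound in the mean, as [mu] has mass 1. [be] is
    extended to admit an infinite slope. *)
Lemma integral_affine_le d (T : measurableType d) (R : realType)
    (mu : probability T R) (X : T -> R) (g : T -> \bar R) (al : R) (be : \bar R) :
  measurable_fun setT X -> (forall x, 0 <= X x) ->
  measurable_fun setT g -> (forall x, 0 <= g x)%E ->
  0 <= al -> (0 <= be)%E -> (forall x, g x <= al%:E + be * (X x)%:E)%E ->
  (\int[mu]_x g x <= al%:E + be * \int[mu]_x (X x)%:E)%E.
Proof.
move=> mX X0 mg g0 al0 be0 gX.
have mX' : measurable_fun setT (fun x => (be * (X x)%:E)%E).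
  apply: measurable_funeM; exact/measurable_EFinP.
have X0' x : (0 <= be * (X x)%:E)%E by rewrite mule_ge0// lee_fin.
apply: (@le_trans _ _ (\int[mu]_x (al%:E + be * (X x)%:E))%E).
  apply: ge0_le_integral => //.
  exact: emeasurable_funD.
rewrite ge0_integralD// integral_cst//.
rewrite (_ : (al%:E * _ = al%:E)%E); last first.
  by rewrite -[RHS]mule1; congr (_ * _)%E; exact: probability_setT.
rewrite ge0_integralZl//.
- exact/measurable_EFinP.
- by move=> x _; rewrite lee_fin.
Qed.

(** * Mean allocations and winning probabilities *)

Definition mean {R : realType} {n : nat} {r : R} (F : strategy n r) (b : 'I_n) : R :=
  fine (\int[st_P F]_x (st_X x b)%:E)%E.

(** Finite because a coordinate is at most the total, whose integral is at most [r]. *)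
Lemma integral_st_X {R : realType} {n : nat} {r : R} (F : strategy n r) b :
  (\int[st_P F]_x (st_X x b)%:E = (mean F b)%:E)%E.
Proof.
rewrite /mean fineK// ge0_fin_numE; last first.
  by apply: integral_ge0 => x _; rewrite lee_fin st_nonneg.
apply: le_lt_trans (ltry r); apply: le_trans (st_budget F).
apply: ge0_le_integral => //.
- by move=> x _; rewrite lee_fin st_nonneg.
- by apply/measurable_EFinP; exact: st_meas.
- by apply/measurable_EFinP; apply: measurable_sum => c; exact: st_meas.
- move=> x _; rewrite lee_fin (bigD1 b)//= lerDl sumr_ge0// => c _.
  exact: st_nonneg.
Qed.

Lemma mean_ge0 {R : realType} {n : nat} {r : R} (F : strategy n r) b :
  0 <= mean F b.
Proof.
by apply: fine_ge0; apply: integral_ge0 => x _; rewrite lee_fin st_nonneg.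
Qed.

Lemma sum_mean_le {R : realType} {n : nat} {r : R} (F : strategy n r) :
  \sum_(b < n) mean F b <= r.
Proof.
rewrite -lee_fin -sumEFin; apply: le_trans (st_budget F).
under [leRHS]eq_integral do rewrite -sumEFin.
rewrite ge0_integral_sum//.
- by under [leRHS]eq_bigr do rewrite integral_st_X.
- by move=> b; apply/measurable_EFinP; exact: st_meas.
- by move=> b x _; rewrite lee_fin st_nonneg.
Qed.

Definition winA {R : realType} {n : nat} (q : R) (p : 'I_n -> R) {RA RB : R}
    (FA : strategy n RA) (FB : strategy n RB) (b : 'I_n) : set (st_T FA * st_T FB) :=
  [set z | q * st_X z.2 b < st_X z.1 b + p b]%classic.

Lemma measurable_winA {R : realType} {n : nat} (q : R) (p : 'I_n -> R) {RA RB : R}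
    (FA : strategy n RA) (FB : strategy n RB) b : measurable (winA q p FA FB b).
Proof.
rewrite -[winA q p FA FB b]setTI; apply: measurable_fun_ltr => //.
- apply: measurable_funM => //.
  exact: (measurableT_comp (st_meas b) measurable_snd).
- apply: measurable_funD => //.
  exact: (measurableT_comp (st_meas b) measurable_fst).
Qed.

(* With [be = +oo] the hypothesis only constrains the [x] where [st_X x b = 0]:
   this covers [RA = 0], where [B]'s strategy may have an atom at [p b]. *)
Lemma prob_winA_le {R : realType} {n : nat} (q : R) (p : 'I_n -> R) {RA RB : R}
    (FA : strategy n RA) (FB : strategy n RB) b (al : R) (be : \bar R) :
  0 <= al -> (0 <= be)%E ->
  (forall x : st_T FA,
     st_P FB [set y | (q * st_X y b < st_X x b + p b)%R]%classic
       <= al%:E + be * (st_X x b)%:E)%E ->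
  ((st_P FA \x st_P FB) (winA q p FA FB b) <= al%:E + be * (mean FA b)%:E)%E.
Proof.
move=> al0 be0 H; rewrite -integral_st_X.
apply: integral_affine_le => //.
- exact: st_meas.
- by move=> x; exact: st_nonneg.
- by apply: measurable_fun_xsection; exact: measurable_winA.
- move=> x /=; apply: le_trans (H x); apply: eq_implies_le.
  by congr (st_P FB _); apply/seteqP; split => y; rewrite /xsection/= inE.
Qed.

(** The hypothesis fixes [B]'s bid, so the complement of [winA] is integrated over [B]'s law and
    then subtracted from the total mass 1. *)
Lemma prob_winA_ge {R : realType} {n : nat} (q : R) (p : 'I_n -> R) {RA RB : R}
    (FA : strategy n RA) (FB : strategy n RB) b (al be : R) :
  0 <= al -> 0 <= be ->
  (forall y : st_T FB,
     st_P FA [set x | (st_X x b + p b <= q * st_X y b)%R]%classic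
       <= (al + be * st_X y b)%R%:E)%E ->
  1 - (al + be * mean FB b) <=
    fine ((st_P FA \x st_P FB)%E (winA q p FA FB b)).
Proof.
move=> al0 be0 H.
have mW := measurable_winA q p FA FB b.
have LC : ((st_P FA \x st_P FB) (~` winA q p FA FB b)%classic <= (al + be * mean FB b)%:E)%E.
  rewrite EFinD EFinM -integral_st_X.
  (* Sections at a fixed bid of [B] need the other order of integration; uniqueness of the product
     measure identifies the two. *)
  rewrite (_ : (_ \x _)%E _ = (st_P FA \x^ st_P FB) (~` winA q p FA FB b)%classic)%E.
    apply: integral_affine_le => //.
    - exact: st_meas.
    - by move=> x; exact: st_nonneg.
    - by apply: measurable_fun_ysection; exact: measurableC.
    - move=> y /=; apply: le_trans (H y); apply: eq_implies_le.
      congr (st_P FA _); apply/seteqP; split => x; rewrite /ysection/= inE /winA/=.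
        by move/negP; rewrite -leNgt.
      by move=> ?; apply/negP; rewrite -leNgt.
  apply: (@product_measure_unique _ _ _ _ _ _ _ (st_P FA \x^ st_P FB)%E) => //.
  - by move=> *; exact: product_measure2E.
  - exact: measurableC.
have : ((st_P FA \x st_P FB) (winA q p FA FB b) +
    (st_P FA \x st_P FB) (~` winA q p FA FB b)%classic = 1)%E.
  rewrite -measureU//; [|exact: measurableC|exact: setICr].
  rewrite setUv -setXTT [LHS]product_measure1E// -[RHS]mule1.
  by congr (_ * _)%E; exact: probability_setT.
move: LC.
have : (0 <= (st_P FA \x st_P FB) (winA q p FA FB b))%E by [].
case: ((st_P FA \x st_P FB)%E (winA q p FA FB b)) => [a| |]//=;
  case: ((st_P FA \x st_P FB)%E (~` winA q p FA FB b)%classic) => [c| |]//=.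
rewrite -EFinD !lee_fin => _ cle [ac]; lra.
Qed.

(** * The explicit mixed strategies of [A] and [B] *)

Lemma integral_unif01_affine {R : realType} (f : R -> R) (a b m k : R) :
  0 <= a -> a <= b -> b <= 1 ->
  measurable_fun [set: R]%classic f -> (forall t, 0 <= f t) ->
  (forall t, a <= t <= b -> f t = m + k * t) ->
  (forall t, 0 <= t <= 1 -> ~~ (a <= t <= b) -> f t = 0) ->
  (\int[unif01 R]_t (f t)%:E =
    (m * (b - a) + k * (b ^+ 2 - a ^+ 2) / 2)%:E)%E.
Proof.
move=> a0 ab b1 mf f0 fin fout.
rewrite /unif01 integral_uniform; last 2 first.
- exact/measurable_EFinP.
- by move=> t; rewrite lee_fin.
rewrite subr0 invr1 mul1e -integral_affine//.
rewrite integral_mkcond [RHS]integral_mkcond.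
apply: eq_integral => t _; rewrite !patchE !mem_setE !in_itv/=.
case: ifPn => t01; case: ifPn => tab //.
- by rewrite fin.
- by rewrite fout.
- by case/negP: t01; case/andP: tab => at_ tb; rewrite (le_trans a0 at_) (le_trans tb b1).
Qed.

(** One uniform variable drives all battlefields; as [s] sums to 1, the total has mean
    [(L - c)^2 / (2 * L)]. [y] may be negative, because [A]'s pre-allocation will be subtracted from
    [B]'s bid. *)
Lemma exists_strategyA {R : realType} {n : nat} (s : 'I_n -> R) (RA L c : R) :
  (forall b, 0 < s b) -> \sum_(b < n) s b = 1 -> 0 <= c -> c <= L -> 0 < L ->
  (L - c) ^+ 2 / (2 * L) <= RA ->
  exists FA : strategy n RA, forall b (y : R), 0 <= c + y ->
    (st_P FA [set x | (st_X x b <= s b * y)%R]%classic <= ((c + y) / L)%R%:E)%E.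
Proof.
move=> s0 s1 c0 cL L0 HR.
pose X (t : measurableTypeR R) (b : 'I_n) := s b * Num.max (L * t - c) 0.
have mM : measurable_fun [set: R]%classic (fun t : R => Num.max (L * t - c) 0).
  by apply: measurable_maxr => //; apply: measurable_funB => //; apply: measurable_funM.
have mX b : measurable_fun setT (fun t => X t b) by exact: measurable_funM.
have X0 t b : 0 <= X t b by rewrite mulr_ge0 ?(ltW (s0 b))// le_max lexx orbT.
have bX : (\int[unif01 R]_t (\sum_(b < n) X t b)%:E <= RA%:E)%E.
  under eq_integral do rewrite -mulr_suml s1 mul1r.
  rewrite (@integral_unif01_affine _ _ (c / L) 1 (- c) L)//.
  - rewrite lee_fin; apply: le_trans HR; apply: eq_implies_le.
    by field; rewrite gt_eqF.
  - by rewrite divr_ge0// ltW.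
  - by rewrite ler_pdivrMr// mul1r.
  - by move=> t; rewrite le_max lexx orbT.
  - move=> t /andP[]; rewrite ler_pdivrMr// => h _.
    by rewrite max_l; lra.
  - move=> t /andP[t0 ->]; rewrite andbT -ltNge ltr_pdivlMr// => h.
    by rewrite max_r; lra.
exists (Strategy mX X0 bX) => b y cy /=.
rewrite -[((c + y) / L)]subr0; apply: unif01_le.
- by rewrite divr_ge0// ltW.
- rewrite -[X in measurable X]setTI; apply: measurable_fun_ler => //; exact: mX.
- move=> t; rewrite /= /X ler_pM2l// ge_max => /andP[h _] /andP[-> _] /=.
  by rewrite ler_pdivlMr//; lra.
Qed.

(** [B] enters when [t <= mu], and then [h / mu * t] is uniform on [0, h]. For [h = 0] it only
    matches [p b], which any positive amount beats: hence the infinite slope. *)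
Lemma exists_strategyB {R : realType} {n : nat} (s p : 'I_n -> R) (q P RB h mu : R) :
  (forall b, 0 < s b) -> \sum_(b < n) s b = 1 -> preSimplex P p ->
  0 < q -> 0 <= h -> 0 < mu -> mu <= 1 -> mu * (P + h / 2) <= q * RB ->
  exists FB : strategy n RB, forall b (x : R), 0 <= x ->
    (st_P FB [set y | (q * st_X y b < s b * x + p b)%R]%classic <=
     (1 - mu)%R%:E + (if h == 0%R then +oo else (mu / h)%:E) * x%:E)%E.
Proof.
move=> s0 s1 [p0 pP] q0 h0 mu0 mu1 HR.
pose X (t : measurableTypeR R) (b : 'I_n) :=
  if (0 <= t) && (t <= mu) then q^-1 * (p b + s b * (h / mu * t)) else 0.
have k0 : 0 <= h / mu by rewrite divr_ge0// ltW.
have mX b : measurable_fun setT (fun t => X t b).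
  apply: measurable_fun_ifT => //.
    by apply: measurable_and; exact: measurable_fun_ler.
  apply: measurable_funM => //; apply: measurable_funD => //.
  by do 2 apply: measurable_funM => //.
have X0 t b : 0 <= X t b.
  rewrite /X; case: ifP => // /andP[t0 _].
  by rewrite mulr_ge0 ?invr_ge0 ?(ltW q0)// addr_ge0// mulr_ge0 ?(ltW (s0 b))// mulr_ge0.
have bX : (\int[unif01 R]_t (\sum_(b < n) X t b)%:E <= RB%:E)%E.
  rewrite (@integral_unif01_affine _ _ 0 mu (q^-1 * P) (q^-1 * (h / mu)))//.
  - rewrite lee_fin -(ler_pM2l q0); apply: le_trans HR.
    apply: eq_implies_le.
    by field; rewrite !gt_eqF.
  - exact: ltW.
  - by apply: measurable_sum => b; exact: mX.
  - by move=> t; apply: sumr_ge0 => b _; exact: X0.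
  - move=> t t01; rewrite /X; under eq_bigr do rewrite t01.
    by rewrite -mulr_sumr big_split/= pP -mulr_suml s1 mul1r; ring.
  - by move=> t _ /negbTE t01; rewrite /X; under eq_bigr do rewrite t01; rewrite big1.
exists (Strategy mX X0 bX) => b x x0 /=.
have mS : measurable [set y | (q * X y b < s b * x + p b)%R]%classic.
  rewrite -[X in measurable X]setTI; apply: measurable_fun_ltr => //.
  exact: measurable_funM.
have Xin t : 0 <= t -> t <= mu -> (q * X t b < s b * x + p b) = (h / mu * t < x).
  move=> t0 tmu; rewrite /X t0 tmu/= mulVKf ?gt_eqF// addrC ltrD2r.
  by rewrite ltr_pM2l.
(* For [h = 0] only [x = 0] has content, where [+oo * 0 = 0]: ties go to [B], so [A] wins only for
   [t >= mu]. *)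
case: ifPn => [/eqP hE|hn].
  move: x0; rewrite le_eqVlt => /predU1P[x0|x0]; last first.
    by rewrite gt0_mulye// addey// leey.
  subst x; rewrite mule0 adde0; apply: unif01_le => // t /= St /andP[t0 ->].
  rewrite andbT leNgt; apply/negP => tmu; move: St.
  by rewrite Xin// ?ltW// hE !mul0r ltxx.
have hgt : 0 < h by rewrite lt_def hn.
have mux : 0 <= mu / h * x by rewrite mulr_ge0// divr_ge0// ltW.
have mA : measurable [set t : R | (mu <= t)%R]%classic.
  by rewrite -[X in measurable X]setTI; apply: measurable_fun_ler.
have mB : measurable [set t : R | (t <= mu / h * x)%R]%classic.
  by rewrite -[X in measurable X]setTI; apply: measurable_fun_ler.
(* [A] wins only if [t >= mu] or the surplus [h / mu * t] is below [x]; a union bound adds the two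
   probabilities. *)
apply: (@le_trans _ _ (unif01 R ([set t : R | (mu <= t)%R] `|`
    [set t : R | (t <= mu / h * x)%R])%classic)).
  apply: le_measure; rewrite ?inE//; first exact: measurableU.
  move=> t /= St; have [mut|tmu] := leP mu t; first by left.
  right; have [t0|t0] := ltP t 0; first exact: le_trans (ltW t0) mux.
  move: St; rewrite Xin// ?(ltW tmu)// => /ltW.
  by rewrite mulrAC ler_pdivrMr// mulrAC ler_pdivlMr// mulrC (mulrC x).
apply: (le_trans (measureU2 (unif01 R) mA mB)); apply: leeD.
- by apply: unif01_le => // t /= -> /andP[_ ->].
- by rewrite -EFinM -[X in (_ <= X%:E)%E]subr0; apply: unif01_le => // t /= -> /andP[->].
Qed.

(** * Payoff bounds from the two strategies *)

Lemma payoffA_ge0 {R : realType} {n : nat} (w : 'I_n -> R) (q : R) (p : 'I_n -> R)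
    {RA RB : R} (FA : strategy n RA) (FB : strategy n RB) :
  (forall b, 0 < w b) -> 0 <= payoffA w q p FA FB.
Proof.
by move=> w0; apply: sumr_ge0 => b _; rewrite mulr_ge0 ?(ltW (w0 b))// fine_ge0.
Qed.

(** The factor [w b] cancels the slope's [W / w b], so [A]'s means enter only through their total,
    at most [RA]. For [h = 0] the quotient [mu / h] is 0 by convention, harmless as [RA = 0]. *)
Lemma payoffA_ub {R : realType} {n : nat} (w p : 'I_n -> R) (q P RA RB h mu : R) :
  let W := \sum_(b < n) w b in
  (forall b, 0 < w b) -> 0 < W -> 0 < q -> 0 <= RA -> preSimplex P p ->
  0 <= h -> (h = 0 -> RA = 0) -> 0 < mu <= 1 -> mu * (P + h / 2) <= q * RB ->
  exists FB : strategy n RB, forall FA : strategy n RA,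
    payoffA w q p FA FB <= W * (1 - mu + mu / h * RA).
Proof.
move=> W w0 W0 q0 RA0 pP h0 hRA /andP[mu0 mu1] HB.
have s0 b : 0 < w b / W by rewrite divr_gt0.
have s1 : \sum_(b < n) w b / W = 1 by rewrite -mulr_suml divff ?gt_eqF.
have [FB HFB] := exists_strategyB _ _ _ _ _ _ _ s0 s1 pP q0 h0 mu0 mu1 HB.
exists FB => FA.
have muh0 : 0 <= mu / h by rewrite divr_ge0// ltW.
suff win_le b : fine ((st_P FA \x st_P FB)%E (winA q p FA FB b)) <=
    1 - mu + mu / h * (mean FA b / (w b / W)).
  apply: (@le_trans _ _ (\sum_(b < n) (w b * (1 - mu) + W * (mu / h) * mean FA b))).
    apply: ler_sum => b _; rewrite /= -/(winA q p FA FB b).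
    apply: le_trans (ler_wpM2l (ltW (w0 b)) (win_le b)) _.
    apply: eq_implies_le; rewrite mulrDr; congr (_ + _).
    have [->|hn] := eqVneq h 0; first by rewrite invr0; ring.
    by field; rewrite hn !gt_eqF.
  rewrite big_split/= -mulr_suml -mulr_sumr -/W [leRHS]mulrDr lerD2l -mulrA.
  by rewrite !ler_wpM2l ?(ltW W0) ?sum_mean_le.
set be : \bar R := if h == 0%R then +oo%E else (mu / h)%:E.
have be0 : (0 <= be * (w b / W)^-1%:E)%E.
  rewrite mule_ge0 ?lee_fin ?invr_ge0 ?(ltW (s0 b))// /be.
  by case: ifP => // _; rewrite lee_fin.
have : ((st_P FA \x st_P FB) (winA q p FA FB b) <=
    (1 - mu)%:E + be * (w b / W)^-1%:E * (mean FA b)%:E)%E.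
  apply: prob_winA_le => [|//|x]; first by rewrite subr_ge0.
  have := HFB b (st_X x b / (w b / W)).
  rewrite (mulrC (w b / W)) (divfK (lt0r_neq0 (s0 b))) -/be => /(_ _)/le_trans; apply.
    by rewrite divr_ge0 ?st_nonneg ?(ltW (s0 b)).
  by rewrite EFinM muleA muleAC.
have : (0 <= (st_P FA \x st_P FB) (winA q p FA FB b))%E by [].
have -> : ((1 - mu)%:E + be * (w b / W)^-1%:E * (mean FA b)%:E =
    (1 - mu + mu / h * (mean FA b / (w b / W)))%:E)%E.
  (* When the slope is infinite, [RA = 0] forces every mean to vanish. *)
  rewrite /be; case: eqP => [hE|_].
    have -> : mean FA b = 0.
      apply/eqP; rewrite eq_le mean_ge0 andbT.
      apply: le_trans (_ : RA <= 0); last by rewrite hRA.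
      apply: le_trans (sum_mean_le FA); rewrite (bigD1 b)//= lerDl.
      by apply: sumr_ge0 => c _; exact: mean_ge0.
    by rewrite mule0 mul0r mulr0 adde0 addr0.
  by rewrite -!EFinM -EFinD; congr (_ + _)%:E; ring.
by case: ((st_P FA \x st_P FB)%E _) => //= r _; rewrite lee_fin.
Qed.

(** As [p b = P * (w b / W)], a bid [y] of [B] wins iff [A] sends at most [w b / W] times
    [q * y / (w b / W) - P]. This is at least [-P], so [P <= c] makes [exists_strategyA]
    applicable. *)
Lemma payoffA_lb {R : realType} {n : nat} (w : 'I_n -> R) (q P RA RB L c : R) :
  let W := \sum_(b < n) w b in
  (forall b, 0 < w b) -> 0 < W -> 0 < q -> 0 <= P ->
  P <= c <= L -> 0 < L -> (L - c) ^+ 2 / (2 * L) <= RA ->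
  exists FA : strategy n RA, forall FB : strategy n RB,
    W * (1 - (c - P + q * RB) / L) <= payoffA w q (fun b => P / W * w b) FA FB.
Proof.
move=> W w0 W0 q0 P0 /andP[Pc cL] L0 HA.
have s0 b : 0 < w b / W by rewrite divr_gt0.
have s1 : \sum_(b < n) w b / W = 1 by rewrite -mulr_suml divff ?gt_eqF.
have [FA HFA] := exists_strategyA _ _ _ _ s0 s1 (le_trans P0 Pc) cL L0 HA.
exists FA => FB.
have win_ge b : 1 - ((c - P) / L + q / (w b / W) / L * mean FB b) <=
    fine ((st_P FA \x st_P FB)%E (winA q (fun b => P / W * w b) FA FB b)).
  apply: prob_winA_ge => [||y].
  - by rewrite divr_ge0 ?subr_ge0// ltW.
  - by rewrite !divr_ge0// ltW.
  - have qy0 : 0 <= q * st_X y b / (w b / W).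
      by rewrite divr_ge0 ?(ltW (s0 b))// mulr_ge0 ?st_nonneg// ltW.
    have -> : (c - P) / L + q / (w b / W) / L * st_X y b =
        (c + (q * st_X y b / (w b / W) - P)) / L.
      by field; rewrite !gt_eqF.
    apply: le_trans (HFA b _ _); last by rewrite addrCA addr_ge0// subr_ge0.
    apply: eq_implies_le.
    congr (st_P FA _); apply/seteqP; split => x /=.
      rewrite mulrBr (mulrC (w b / W) (q * _ / _)) (divfK (lt0r_neq0 (s0 b))) => H.
      by rewrite lerBrDr (_ : w b / W * P = P / W * w b)//; ring.
    rewrite mulrBr (mulrC (w b / W) (q * _ / _)) (divfK (lt0r_neq0 (s0 b))) lerBrDr.
    by rewrite (_ : w b / W * P = P / W * w b)//; ring.
apply: (@le_trans _ _ (\sum_(b < n) (w b * (1 - (c - P) / L) - W * (q / L) * mean FB b))).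
  rewrite sumrB -mulr_suml -mulr_sumr -/W.
  rewrite (_ : W * (1 - _) = W * (1 - (c - P) / L) - W * (q / L) * RB); last by ring.
  rewrite lerD2l lerN2 ler_wpM2l ?sum_mean_le//.
  by rewrite mulr_ge0 ?divr_ge0// ltW.
apply: ler_sum => b _; rewrite /= -/(winA q (fun b => P / W * w b) FA FB b).
apply: le_trans (ler_wpM2l (ltW (w0 b)) (win_ge b)).
apply: eq_implies_le.
by field; rewrite !gt_eqF.
Qed.

(** * Parameters in the two regimes *)

(** [h] is a root of the quadratic that makes [A]'s budget bind; the last bound keeps [B]'s entry
    probability [Q / (P + h / 2)] at most 1. *)
Lemma reserve_width {R : realType} (P RA Q : R) :
  0 <= P -> 0 <= RA -> 0 < Q ->
  ~~ ((P < Q) && (RA < 2 * (Q - P) ^+ 2 / (P + 2 * (Q - P)))) ->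
  let h := RA + Num.sqrt ((RA + P) ^+ 2 - P ^+ 2) in
  [/\ RA <= h, h ^+ 2 = 2 * RA * (P + h), 0 < P + h & 2 * (Q - P) <= h].
Proof.
move=> P0 RA0 Q0 HN h.
have RAh : RA <= h by rewrite lerDl sqrtr_ge0.
have h2 : h ^+ 2 = 2 * RA * (P + h).
  have D0 : 0 <= (RA + P) ^+ 2 - P ^+ 2.
    by rewrite subr_ge0 ler_pXn2r ?nnegrE ?addr_ge0// lerDr.
  by rewrite /h sqrrD sqr_sqrtr//; ring.
have Ph0 : 0 < P + h.
  have Ph0 : 0 <= P + h by lra.
  (* [P + h = 0] forces [P = RA = 0], which falls under the excluded condition. *)
  rewrite lt_def Ph0 andbT; apply/eqP => Ph.
  have PE : P = 0 by lra.
  have RAE : RA = 0 by lra.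
  move: HN; rewrite PE RAE Q0/= subr0 add0r => /negP; apply.
  by rewrite divr_gt0// mulr_gt0// exprn_gt0.
split => //; have [PQ|QP] := ltP P Q; last by lra.
move: HN; rewrite PQ/= -leNgt; set d := Q - P.
have d0 : 0 < d by rewrite subr_gt0.
have Pd0 : 0 < P + 2 * d by lra.
(* [h^2 / (P + h)] increases with [h] and equals [2 * RA]; [h < 2 * d] would put it below
   [4 * d^2 / (P + 2 * d)], against [HN]. *)
rewrite ler_pdivrMr// => HN; rewrite leNgt; apply/negP => hd.
have h0 : 0 <= h by lra.
nra.
Qed.

Lemma A_guarantees {R : realType} {n : nat} (w : 'I_n -> R) (q P RA RB : R) :
  let W := \sum_(b < n) w b in
  (forall b, 0 < w b) -> 0 < W -> 0 < q -> 0 <= P -> 0 <= RA -> 0 < RB ->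
  exists FA : strategy n RA, forall FB : strategy n RB,
    piA_star W q P RA RB <= payoffA w q (fun b => P / W * w b) FA FB.
Proof.
move=> W w0 W0 q0 P0 RA0 RB0; rewrite /piA_star.
have Q0 : 0 < q * RB by rewrite mulr_gt0.
set Q := q * RB in Q0 *.
case: ifPn => [/andP[PQ]|].
  set d := Q - P; have d0 : 0 < d by rewrite subr_gt0.
  have Pd0 : 0 < P + 2 * d by lra.
  rewrite ltr_pdivlMr// => RAd.
  have [RAE|RAn] := eqVneq RA 0.
    (* Here [v = 0], so any strategy of [A] will do. *)
    have [|||FA _] := @payoffA_lb R n w q P RA RB (P + 1) (P + 1) w0 W0 q0 P0.
    - by rewrite lexx andbT; lra.
    - lra.
    - by rewrite subrr expr0n mul0r.
    exists FA => FB; rewrite [X in _ * (X / _)]RAE mul0r mulr0; exact: payoffA_ge0.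
  have RAgt : 0 < RA by rewrite lt_def RAn.
  have L0 : 0 < 2 * d ^+ 2 / RA by rewrite divr_gt0// mulr_gt0// exprn_gt0.
  have [|||FA HFA] := @payoffA_lb R n w q P RA RB (2 * d ^+ 2 / RA)
    (2 * d ^+ 2 / RA - 2 * d) w0 W0 q0 P0.
  (* [P <= L - 2 * d] is the threshold condition on [RA], in weak form. *)
  - rewrite lerBrDr ler_pdivlMr// mulrC (ltW RAd)/= gerBl; lra.
  - exact: L0.
  - apply: eq_implies_le.
    by field; rewrite !gt_eqF.
  exists FA => FB; apply: le_trans (HFA FB).
  (* Here [c - P + Q = L - d], which leaves [d / L = RA / (2 * d)]. *)
  apply: eq_implies_le; congr (_ * _).
  rewrite -/Q (_ : Q = P + d); last by rewrite /d; ring.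
  by field; rewrite !gt_eqF.
move=> HN; have [RAh h2 Ph0 _] := @reserve_width R P RA Q P0 RA0 Q0 HN.
rewrite -(addrA P); move: (RA + _) RAh h2 Ph0 => h RAh h2 Ph0.
have [|||FA HFA] := @payoffA_lb R n w q P RA RB (P + h) P w0 W0 q0 P0.
- by rewrite lexx/=; lra.
- exact: Ph0.
- rewrite addrAC subrr add0r h2; apply: eq_implies_le.
  by field; rewrite gt_eqF.
by exists FA => FB; apply: le_trans (HFA FB); rewrite subrr add0r.
Qed.

Lemma B_guarantees {R : realType} {n : nat} (w p : 'I_n -> R) (q P RA RB : R) :
  let W := \sum_(b < n) w b in
  (forall b, 0 < w b) -> 0 < W -> 0 < q -> 0 <= RA -> 0 < RB -> preSimplex P p ->
  exists FB : strategy n RB, forall FA : strategy n RA,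
    payoffA w q p FA FB <= piA_star W q P RA RB.
Proof.
move=> W w0 W0 q0 RA0 RB0 pP; rewrite /piA_star.
have P0 : 0 <= P by case: pP => p0 <-; exact: sumr_ge0.
have Q0 : 0 < q * RB by rewrite mulr_gt0.
case: ifPn => [/andP[PQ _]|HN].
  have d0 : 0 < q * RB - P by rewrite subr_gt0.
  have [||||FB HFB] := @payoffA_ub R n w p q P RA RB (2 * (q * RB - P)) 1 w0 W0 q0 RA0 pP.
  - lra.
  - lra.
  - by rewrite ltr01 lexx.
  - by rewrite mul1r; lra.
  exists FB => FA; apply: le_trans (HFB FA) _.
  by rewrite subrr add0r mul1r [_^-1 * RA]mulrC.
have [RAh h2 Ph0 dh] := @reserve_width R P RA (q * RB) P0 RA0 Q0 HN.
rewrite -(addrA P); move: (RA + _) RAh h2 Ph0 dh => h RAh h2 Ph0 dh.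
have Ph2 : 0 < P + h / 2 by lra.
have [||||FB HFB] := @payoffA_ub R n w p q P RA RB h (q * RB / (P + h / 2)) w0 W0 q0 RA0 pP.
- lra.
- lra.
- by rewrite divr_gt0//= ler_pdivrMr// mul1r; lra.
- by rewrite divfK// gt_eqF.
exists FB => FA; apply: le_trans (HFB FA) _.
apply: eq_implies_le; congr (_ * _).
have [h0|hn] := eqVneq h 0.
  have -> : RA = 0 by lra.
  by rewrite h0 mul0r mulr0 !addr0.
(* With this [RA], the bound is [1 - mu * (2 * P + h) / (2 * (P + h))], which is
   [1 - Q / (P + h)]. *)
have -> : RA = h ^+ 2 / (2 * (P + h)) by rewrite h2; field; rewrite gt_eqF.
by field; rewrite hn !gt_eqF//; lra.
Qed.

(** * Equilibrium payoff and optimality of [pstar] *)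

Theorem theorem1 (R : realType) (n : nat) (w : 'I_n -> R) (q P RA RB : R) :
  (1 <= n)%N -> (forall b, 0 < w b) -> 0 < q -> 0 <= P -> 0 <= RA -> 0 < RB ->
  let W := \sum_(b < n) w b in
  let pstar := fun b => P / W * w b in
  let v := piA_star W q P RA RB in
  [/\ preSimplex P pstar,
      (* (i)+(ii): p* attains the equilibrium payoff v, which is its unique one *)
      is_eq_payoffA w q pstar RA RB v,
      (forall u, is_eq_payoffA w q pstar RA RB u -> u = v),
      (* p* is optimal: no pre-allocation gives A a larger equilibrium payoff *)
      (forall p, preSimplex P p ->
         forall u, is_eq_payoffA w q p RA RB u -> u <= v)
    & (* B's equilibrium payoff is W - v *)
      (forall FA FB, @is_nash R n w q pstar RA RB FA FB ->
         payoffB w q pstar FA FB = W - v)].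
Proof.
move=> n1 w0 q0 P0 RA0 RB0 W pstar v.
have W0 : 0 < W.
  rewrite /W (bigD1 (Ordinal n1))//= ltr_wpDr//.
  by apply: sumr_ge0 => b _; exact: ltW.
have pstarP : preSimplex P pstar.
  split=> [b|]; first by rewrite mulr_ge0 ?divr_ge0 ?(ltW W0) ?(ltW (w0 b)).
  by rewrite -mulr_sumr divfK// gt_eqF.
have [FA HA] := @A_guarantees R n w q P RA RB w0 W0 q0 P0 RA0 RB0.
(* [B] does not gain by deviating to its guarantee strategy, which would hold [A] to [v]. *)
have ub p : preSimplex P p -> forall u, is_eq_payoffA w q p RA RB u -> u <= v.
  move=> pP u [FA' [FB' [[_ nB] <-]]].
  have [FB HB] := @B_guarantees R n w p q P RA RB w0 W0 q0 RA0 RB0 pP.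
  have := nB FB; rewrite /payoffB lerD2l lerN2 => /le_trans; apply.
  exact: HB.
have eqv (FA' : strategy n RA) (FB' : strategy n RB) :
    is_nash w q pstar FA' FB' -> payoffA w q pstar FA' FB' = v.
  move=> N; apply/eqP; rewrite eq_le; apply/andP; split.
    by apply: (ub _ pstarP); exists FA', FB'.
  by apply: le_trans (HA FB') _; exact: N.1.
split => //.
(* At [pstar] the two guarantee strategies form a saddle point with value [v]. *)
- have [FB HB] := @B_guarantees R n w pstar q P RA RB w0 W0 q0 RA0 RB0 pstarP.
  have Ev : payoffA w q pstar FA FB = v.
    by apply/eqP; rewrite eq_le HB HA.
  exists FA, FB; split => //; split => F; first by rewrite Ev; exact: HB.
  by rewrite /payoffB lerD2l lerN2 Ev; exact: HA.
- by move=> u [FA' [FB' [N <-]]]; exact: eqv.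
- by move=> FA' FB' /eqv; rewrite /payoffB => ->.
Qed.
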